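(* (Lévy's zero-one law) Fix an imprecise probability tree $(\overline{\mathrm Q}_s)_{s\in\mathscr X^\ast}$ with corresponding global upper expectation $\overline{\mathrm E}_{\mathrm V}$. For any bounded below $f\in\overline{\mathbb V}_b$ and any situation $s'\in\mathscr X^\ast$, the event $$A:=\Big\{\omega\in\Gamma(s')\colon \liminf_{n\to+\infty}\overline{\mathrm E}_{\mathrm V}(f\vert\omega^n)\ge f(\omega)\Big\}$$ is strictly almost sure within $\Gamma(s')$.
   Context: $\overline{\mathbb R}=\mathbb R\cup\{+\infty,-\infty\}$, $\mathbb N=\{1,2,\dots\}$, $\mathbb N_0=\mathbb N\cup\{0\}$. Conventions: $+\infty-\infty=-\infty+\infty=+\infty$, $0\cdot(\pm\infty)=0$, otherwise the usual arithmetic on $\overline{\mathbb R}$. For a non-empty set $\mathscr Y$, $\overline{\mathscr L}_b(\mathscr Y)$ is the set of all maps $f\colon\mathscr Y\to\overline{\mathbb R}$ that are bounded below (there is $M\in\mathbb R$ with $f\ge M$). An upper expectation on $\overline{\mathscr L}_b(\mathscr Y)$ is a map $\overline{\mathrm E}\colon\overline{\mathscr L}_b(\mathscr Y)\to\overline{\mathbb R}$ such that: (E1) $\overline{\mathrm E}(c)=c$ for all constants $c\in\mathbb R$; (E2) $\overline{\mathrm E}(f+g)\le\overline{\mathrm E}(f)+\overline{\mathrm E}(g)$ for all $f,g$; (E3) $\overline{\mathrm E}(\lambda f)=\lambda\overline{\mathrm E}(f)$ for all $\lambda\in(0,+\infty)\cup\{+\infty\}$ and all non-negative $f$; (E4)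 $f\le g$ implies $\overline{\mathrm E}(f)\le\overline{\mathrm E}(g)$. $\mathscr X$ is a fixed non-empty finite set (state space). A situation is a finite string $x_{1:n}=(x_1,\dots,x_n)\in\mathscr X^n$, $n\in\mathbb N_0$ (the empty string is denoted $\Box$); $\mathscr X^\ast$ is the set of all situations; $sx$ is the string $s$ followed by $x\in\mathscr X$. $\Omega=\mathscr X^{\mathbb N}$ is the set of paths; for $\omega\in\Omega$, $\omega^n$ is the string of its first $n$ entries. $\Gamma(s)$ is the set of all paths that start with the string $s$. $\overline{\mathbb V}$ is the set of all maps $\Omega\to\overline{\mathbb R}$ and $\overline{\mathbb V}_b=\overline{\mathscr L}_b(\Omega)$. For $f,g\in\overline{\mathbb V}$, $f\ge_s g$ means $f(\omega)\ge g(\omega)$ for all $\omega\in\Gamma(s)$. An imprecise probability tree assigns to every $s\in\mathscr X^\ast$ an upper expectation $\overline{\mathrm Q}_s$ on $\overline{\mathscr L}_b(\mathscr X)$. A supermartingale (for the given tree) is a map $\mathscr M\colon\mathscr X^\ast\to\overline{\mathbb R}$ that is bounded below by a real constant and satisfies $\overline{\mathrm Q}_s(\mathscr M(s\,\cdot))\le\mathscr M(s)$ for all $s\in\mathscr X^\ast$, where $\mathscr M(s\,\cdot)(x)=\mathscr M(sx)$. $\overline{\mathbb M}_{\mathrm b}$ is the set of all supermartingales, and $\liminf\mathscr M(\omega):=\liminf_{n\to+\infty}\mathscr M(\omega^n)$. The global upper expectation is, for $f\in\overline{\mathbb V}$ and $s\in\mathscr X^\ast$, $$\overline{\mathrm E}_{\mathrm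 V}(f\vert s):=\inf\{\mathscr M(s)\colon\mathscr M\in\overline{\mathbb M}_{\mathrm b}\text{ and }\liminf\mathscr M\ge_s f\}.$$ An $s$-test supermartingale is a non-negative supermartingale $\mathscr M$ with $\mathscr M(s)=1$. An event $A\subseteq\Gamma(s)$ is strictly almost sure (s.a.s.) within $\Gamma(s)$ if there is an $s$-test supermartingale $\mathscr T$ with $\lim_{n\to+\infty}\mathscr T(\omega^n)=+\infty$ for all $\omega\in\Gamma(s)\setminus A$. *)

(* Defs.v *)
From HB Require Import structures.
From mathcomp Require Import all_boot all_order all_algebra.
From mathcomp Require Import all_classical all_reals all_analysis.

Set Implicit Arguments.
Unset Strict Implicit.
Unset Printing Implicit Defensive.

Import Order.TTheory GRing.Theory Num.Theory.
Import numFieldNormedType.Exports.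

Local Open Scope classical_set_scope.
Local Open Scope ring_scope.
Local Open Scope ereal_scope.

Definition bounded_below (R : realType) (Y : Type) (f : Y -> \bar R) : Prop :=
  exists m : R, forall y, m%:E <= f y.

(* A map on the bounded below functions is represented by a map on all
   functions that is constrained, and used below, only on the bounded below
   ones.  [dual_adde] is the addition of [\bar R] with +oo - oo = +oo, whereas
   the default one has +oo - oo = -oo; both have 0 * +oo = 0. *)
Record upper_expectation (R : realType) (Y : Type)
    (E : (Y -> \bar R) -> \bar R) : Prop := UpperExpectation {
  upexp_cst : forall c : R, E (fun=> c%:E) = c%:E ;
  upexp_subadd : forall f g : Y -> \bar R,
    bounded_below f -> bounded_below g ->
    E (fun y => dual_adde (f y) (g y)) <= dual_adde (E f) (E g) ;
  upexp_pscale : forall (l : \bar R) (f : Y -> \bar R),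
    0 < l -> (forall y, 0 <= f y) -> E (fun y => l * f y) = l * E f ;
  upexp_le : forall f g : Y -> \bar R,
    bounded_below f -> bounded_below g ->
    (forall y, f y <= g y) -> E f <= E g }.

Section ImpreciseTree.
Variables (R : realType) (X : finType).

Definition situation : Type := seq X.

(* The (n+1)-st state of the path [w] is [w n]. *)
Definition path_space : Type := nat -> X.

Definition path_prefix (w : path_space) (n : nat) : situation := mkseq w n.

Definition cylinder (s : situation) : set path_space :=
  [set w | path_prefix w (size s) = s].

Definition imprecise_tree (Q : situation -> (X -> \bar R) -> \bar R) : Prop :=
  forall s, upper_expectation (Q s).

Variable Q : situation -> (X -> \bar R) -> \bar R.

Definition supermartingale (M : situation -> \bar R) : Prop :=
  bounded_below M /\ forall s, Q s (fun x => M (rcons s x)) <= M s.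

Definition liminf_path (M : situation -> \bar R) (w : path_space) : \bar R :=
  limn_einf (fun n => M (path_prefix w n)).

Definition global_upper_expectation (f : path_space -> \bar R)
    (s : situation) : \bar R :=
  ereal_inf [set M s | M in
    [set M | supermartingale M /\
             forall w, cylinder s w -> f w <= liminf_path M w]].

Definition test_supermartingale (s : situation) (T : situation -> \bar R) :=
  [/\ supermartingale T, forall t, 0 <= T t & T s = 1].

Definition strictly_almost_sure (s : situation) (A : set path_space) : Prop :=
  A `<=` cylinder s /\
  exists T, test_supermartingale s T /\
    forall w, (cylinder s `\` A) w -> T (path_prefix w n) @[n --> \oo] --> +oo.

End ImpreciseTree.

(* Main.v *)
Require Import Defs.
From HB Require Import structures.
From mathcomp Require Import all_boot all_order all_algebra.
From mathcomp Require Import all_classical all_reals all_analysis.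

(* Let [a < b].  Whenever [E_V(f|t) < a], some supermartingale [M] costs less than
   [a] at [t] and satisfies [liminf M >= f] on the cylinder of [t].  Buying [M]
   then, selling once its value exceeds [b], and waiting for the next such [t]
   multiplies the capital by a fixed factor [r > 1] per round; on a path with
   [liminf E_V(f|.) < a < b < f] there are infinitely many rounds.  As [M] is
   bounded below by the lower bound of [f] on the cylinder of [t], after a shift
   the capital stays proportional to [r ^ rounds] also during a round, so that it
   tends to +oo rather than being merely unbounded.  A countable convex mixture
   over rational pairs [(a, b)] is a test supermartingale by the countable
   subadditivity of upper expectations on a finite space. *)

Import Order.TTheory GRing.Theory Num.Theory.
Import numFieldNormedType.Exports.

Local Open Scope classical_set_scope.
Local Open Scope ring_scope.
Local Open Scope ereal_scope.

(** * Rational separation and limits inferior in the extended reals *)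

Lemma ratr_between (R : realType) (x y : \bar R) :
  x < y -> exists q : rat, x < (ratr q)%:E < y.
Proof.
move: x y => [r| |] [s| |] //; rewrite ?lte_fin.
- by move=> /rat_in_itvoo[q]; rewrite in_itv /= => qrs; exists q; rewrite !lte_fin.
- move=> _; have /rat_in_itvoo[q] : (r < r + 1)%R by rewrite ltrDl.
  by rewrite in_itv /= => /andP[rq _]; exists q; rewrite lte_fin rq ltry.
- move=> _; have /rat_in_itvoo[q] : (s - 1 < s)%R by rewrite ltrBlDr ltrDl.
  by rewrite in_itv /= => /andP[_ qs]; exists q; rewrite lte_fin qs ltNyr.
- by move=> _; exists 0%R; rewrite ltNyr ltry.
Qed.

Section limn_einf_lt.
Variables (R : realType) (u : (\bar R)^nat) (c : \bar R).

Lemma limn_einf_gt_near : c < limn_einf u -> \forall n \near \oo, c < u n.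
Proof.
rewrite limn_einf_lim (cvg_lim _ (@cvg_einfs_sup _ u))//.
move=> /ereal_sup_gt[_ [n _ <-]] cn.
exists n => // k nk; apply: (lt_le_trans cn).
by apply: ereal_inf_lbound; exists k.
Qed.

Lemma limn_einf_lt_frequently : limn_einf u < c ->
  forall n, exists2 k, (n <= k)%N & u k < c.
Proof.
rewrite limn_einf_lim (cvg_lim _ (@cvg_einfs_sup _ u))// => uc n.
have : einfs u n < c.
  by apply: le_lt_trans uc; apply: ereal_sup_ubound; exists n.
by move=> /ereal_inf_lt[_ [k /= nk <-] ukc]; exists k.
Qed.

End limn_einf_lt.

Lemma dual_addeE_ge0 (R : realType) (x y : \bar R) : 0 <= x -> 0 <= y ->
  dual_adde x y = x + y.
Proof. by case: x y => [x| |] [y| |]. Qed.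

(** * Elementary rules for upper expectations *)

Section upper_expectation_theory.
Context {R : realType} {Y : Type} {E : (Y -> \bar R) -> \bar R}.
Hypothesis hE : upper_expectation E.
Implicit Types f g : Y -> \bar R.

Lemma bounded_below_ge0 f : (forall y, 0 <= f y) -> bounded_below f.
Proof. by move=> f0; exists 0%R. Qed.

Lemma upexp_ge0 f : (forall y, 0 <= f y) -> 0 <= E f.
Proof.
move=> f0; rewrite -[leLHS](upexp_cst hE 0%R).
by apply: (upexp_le hE) => //; apply: bounded_below_ge0.
Qed.

Lemma upexpD_ge0 f g : (forall y, 0 <= f y) -> (forall y, 0 <= g y) ->
  E (fun y => f y + g y) <= E f + E g.
Proof.
move=> f0 g0.
rewrite -dual_addeE_ge0; [|exact: upexp_ge0..].
rewrite (_ : (fun y => _) = (fun y => dual_adde (f y) (g y))).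
  by apply: (upexp_subadd hE); apply: bounded_below_ge0.
by apply/funext => y; rewrite dual_addeE_ge0.
Qed.

(** A real summand never meets opposite infinities, so both additions agree and subadditivity
    applies. *)
Lemma upexpDr f (c : R) : bounded_below f ->
  E (fun y => f y + c%:E) <= E f + c%:E.
Proof.
move=> fb.
have -> : (fun y => f y + c%:E) = (fun y => dual_adde (f y) c%:E).
  by apply/funext => y; case: (f y).
have -> : E f + c%:E = dual_adde (E f) (E (fun=> c%:E)).
  by rewrite (upexp_cst hE); case: (E f).
by apply: (upexp_subadd hE) => //; exists c.
Qed.

Lemma upexp_sum_le (g : nat -> Y -> \bar R) n : (forall k y, 0 <= g k y) ->
  E (fun y => \sum_(0 <= k < n) g k y) <= \sum_(0 <= k < n) E (g k).
Proof.
move=> g0; elim: n => [|n IH].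
  rewrite big_geq// -[leRHS](upexp_cst hE 0%R) le_eqVlt; apply/orP; left; apply/eqP.
  by congr E; apply/funext => y; rewrite big_geq.
rewrite big_nat_recr//=; apply: le_trans (leeD2r _ IH).
have -> : (fun y => \sum_(0 <= k < n.+1) g k y) =
  (fun y => \sum_(0 <= k < n) g k y + g n y).
  by apply/funext => y; rewrite big_nat_recr.
by apply: upexpD_ge0 => // y; apply: sume_ge0.
Qed.

End upper_expectation_theory.

(** * Countable subadditivity on a finite space *)

Section finite_upper_expectation.
Context {R : realType} {X : finType} {E : (X -> \bar R) -> \bar R}.
Hypothesis hE : upper_expectation E.

Lemma near_forall_fin (P : X -> nat -> Prop) :
  (forall x, \forall n \near \oo, P x n) -> \forall n \near \oo, forall x, P x n.
Proof.
move=> hP; have h x : exists N, forall n, (N <= n)%N -> P x n.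
  by have [N _ hN] := hP x; exists N.
have [N hN] := choice h.
exists (\max_x N x)%N => // n /= Nn x; apply: hN.
by apply: leq_trans Nn; exact: leq_bigmax.
Qed.

(* On the set [B] where the series diverges, its partial sums exceed every
   constant simultaneously, which forces [E \1_B = 0] as soon as the bound is
   finite; off [B] the convergence is uniform. *)
Lemma upexp_nneseries_le (g : nat -> X -> \bar R) :
  (forall k x, 0 <= g k x) ->
  E (fun x => \sum_(0 <= k <oo) g k x) <= \sum_(0 <= k <oo) E (g k).
Proof.
move=> g0; set G := fun x => _; set S := \sum_(0 <= k <oo) _.
have Eg0 k : 0 <= E (g k) by apply: upexp_ge0.
have [->|Sfin] := eqVneq S +oo; first by rewrite leey.
have S0 : 0 <= S by apply: nneseries_ge0.
have {}Sfin : S \is a fin_num by rewrite ge0_fin_numE// ltey.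
have ES n : E (fun x => \sum_(0 <= k < n) g k x) <= S.
  apply: le_trans (upexp_sum_le hE _ n g0) _.
  by apply: nneseries_lim_ge.
have G0 x : 0 <= G x by apply: nneseries_ge0.
have cG x : (\sum_(0 <= k < n) g k x) @[n --> \oo] --> G x.
  by apply: is_cvg_nneseries.
pose B := fun x => if G x == +oo then 1 else 0 : \bar R.
have B0 x : 0 <= B x by rewrite /B; case: ifP.
have EB : E B = 0.
  apply/eqP; rewrite eq_le (upexp_ge0 hE)// andbT.
  apply/lee_addgt0Pr => e e0; rewrite add0e.
  (* [A * E B <= S] will give [E B <= e]; the added 1 keeps [A] positive when [S] is 0. *)
  pose A := ((fine S + 1) / e)%R.
  have A0 : (0 < A)%R by rewrite divr_gt0// ltr_wpDl// fine_ge0.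
  have /near_forall_fin : forall x, \forall n \near \oo,
      A%:E * B x <= \sum_(0 <= k < n) g k x.
    move=> x; rewrite /B; case: ifPn => [/eqP Gx|_].
      by rewrite mule1; apply: cvgey_ge; rewrite -Gx.
    by apply: nearW => n; rewrite mule0 sume_ge0.
  move=> [n _ /(_ n (leqnn n)) hn].
  have : A%:E * E B <= S.
    rewrite -(upexp_pscale hE)//; apply: le_trans (ES n).
    apply: (upexp_le hE) => //; apply: bounded_below_ge0 => x.
      by rewrite mule_ge0// lee_fin ltW.
    by apply: sume_ge0.
  rewrite -lee_pdivlMl// => /le_trans; apply.
  rewrite -(fineK Sfin) -EFinM lee_fin /A invf_div.
  rewrite mulrAC ler_pdivrMr ?ltr_wpDl ?fine_ge0//.
  by rewrite ler_pM2l// lerDl.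
apply/lee_addgt0Pr => e e0.
(* The term [+oo * B] covers the points of divergence at no cost: [upexp_pscale] with factor [+oo]
   turns it into [+oo * E B], which is 0. *)
have /near_forall_fin : forall x, \forall n \near \oo,
    G x <= (\sum_(0 <= k < n) g k x + e%:E) + +oo * B x.
  move=> x; rewrite /B; case: ifPn => [_|Gx].
    apply: nearW => n; rewrite mule1 addey ?leey// gt_eqF//.
    by rewrite (lt_le_trans (ltNyr 0))// adde_ge0// ?sume_ge0// lee_fin ltW.
  have Gfin : G x \is a fin_num by rewrite ge0_fin_numE// ltey.
  have : (fine (G x) - e)%:E < G x by rewrite -[ltRHS]fineK// lte_fin ltrBlDr ltrDl.
  move=> Ge; have := cG x _ (open_nbhs_nbhs (conj (@open_ereal_gt_ereal _ _) Ge)).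
  apply: (@filterS _ \oo) => n /=.
  rewrite mule0 adde0 => /ltW; rewrite -leeBlDr//.
  by rewrite EFinB fineK.
move=> [n _ /(_ n (leqnn n)) hn].
have h1 x : 0 <= \sum_(0 <= k < n) g k x by apply: sume_ge0.
have h2 x : 0 <= \sum_(0 <= k < n) g k x + e%:E.
  by rewrite adde_ge0// lee_fin ltW.
have h3 x : 0 <= +oo * B x by rewrite mule_ge0// leey.
apply: (@le_trans _ _ (E (fun x => (\sum_(0 <= k < n) g k x + e%:E) + +oo * B x))).
  apply: (upexp_le hE) => //; apply: bounded_below_ge0 => // x.
  exact: adde_ge0.
apply: (le_trans (upexpD_ge0 hE _ _ h2 h3)).
rewrite (upexp_pscale hE)// EB mule0 adde0.
apply: le_trans (upexpDr hE _ e (bounded_below_ge0 _ h1)) _.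
by rewrite leeD2r.
Qed.

End finite_upper_expectation.

(** * Situations as prefixes of paths *)

Section path_prefix_theory.
Context {X : finType}.
Implicit Types (w : path_space X) (s t u : situation X).

Lemma size_path_prefix w n : size (path_prefix w n) = n.
Proof. exact: size_mkseq. Qed.

Lemma path_prefixS w n : path_prefix w n.+1 = rcons (path_prefix w n) (w n).
Proof. exact: mkseqS. Qed.

Lemma cylinder_path_prefix w n : cylinder (path_prefix w n) w.
Proof. by rewrite /cylinder /= size_path_prefix. Qed.

Lemma cylinder_rcons s x w : cylinder (rcons s x) w -> cylinder s w.
Proof.
rewrite /cylinder /= size_rcons path_prefixS => /eqP.
by rewrite eqseq_rcons => /andP[/eqP].
Qed.

Lemma cylinder_prefix s w n : cylinder s w -> (size s <= n)%N ->
  prefix s (path_prefix w n).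
Proof.
rewrite /cylinder /= => sw; elim: n => [|n IH].
  by rewrite leqn0 => /eqP s0; rewrite -sw s0 prefix_refl.
rewrite leq_eqVlt => /orP[/eqP <-|]; first by rewrite sw prefix_refl.
by rewrite ltnS path_prefixS => /IH/prefix_trans; apply; exact: prefix_rcons.
Qed.

Lemma prefix_cylinder t u w : prefix t u -> cylinder u w -> cylinder t w.
Proof.
move=> /prefixP[v ->]; elim/last_ind: v => [|v x IH]; first by rewrite cats0.
by rewrite -rcons_cat => /cylinder_rcons.
Qed.

Lemma exists_path_following (g : situation X -> X) u : exists w, cylinder u w /\
  forall n, path_prefix w (size u + n) = iter n (fun s => rcons s (g s)) u.
Proof.
pose p n := iter n (fun s => rcons s (g s)) u.
(* The path first reads [u], then follows [g]; [g u] is only the default of [nth], whose index is in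
   range. *)
exists (fun i => if (i < size u)%N then nth (g u) u i else g (p (i - size u)%N)).
set w := (X in cylinder u X).
have wu : path_prefix w (size u) = u.
  apply: (@eq_from_nth _ (g u)); rewrite size_path_prefix// => i iu.
  by rewrite nth_mkseq// /w iu.
split=> //; elim=> [|n IH]; first by rewrite addn0.
by rewrite addnS path_prefixS IH /w ltnNge leq_addr/= addKn.
Qed.

End path_prefix_theory.

(** * Supermartingales on the tree *)

Section supermartingale_theory.
Context {R : realType} {X : finType}.
Context {Q : situation X -> (X -> \bar R) -> \bar R}.
Hypotheses (hX : (0 < #|X|)%N) (hQ : imprecise_tree Q).
Implicit Types (M : situation X -> \bar R) (s t u : situation X).

(** Finitely many successors attain their minimum. Were it above [M s], a rational strictly between
    would bound them all from below, and monotonicity would force it to be at most [M s]. *)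
Lemma supermartingale_descent M s : supermartingale Q M ->
  exists x, M (rcons s x) <= M s.
Proof.
move=> [[m mM] hM]; apply: contrapT => /forallNP nox.
have /card_gt0P[x0 _] := hX.
have [x _ hx] := @Order.TotalTheory.arg_minP _ _ _ x0 xpredT
  (fun x => M (rcons s x)) erefl.
have /ratr_between[q /andP[Mq qM]] : M s < M (rcons s x).
  by rewrite ltNge; apply/negP/nox.
have : (ratr q)%:E <= M s.
  apply: le_trans (hM s); rewrite -(upexp_cst (hQ s)).
  apply: (upexp_le (hQ s)) => [| |y].
  - by exists (ratr q).
  - by exists m.
  - by apply: (le_trans (ltW qM)); apply: hx.
by rewrite leNgt Mq.
Qed.

Lemma supermartingale_descending_path M u : supermartingale Q M ->
  exists2 w, cylinder u w & forall n, M (path_prefix w (size u + n)) <= M u.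
Proof.
move=> hM; have [g hg] := choice (fun s => supermartingale_descent M s hM).
have [w [uw hw]] := exists_path_following g u.
exists w => // n; rewrite hw; elim: n => [//|n IH].
by rewrite iterS; apply: le_trans (hg _) IH.
Qed.

(** Successive descents from [u] give a path in the cylinder of [s] whose limit inferior is at most
    [M u]. *)
Lemma supermartingale_ge M s (c : \bar R) : supermartingale Q M ->
  (forall w, cylinder s w -> c <= liminf_path M w) ->
  forall u, prefix s u -> c <= M u.
Proof.
move=> hM cM u su; rewrite leNgt; apply/negP => Muc.
have [w uw hw] := supermartingale_descending_path M u hM.
have /(lt_le_trans Muc)/limn_einf_gt_near[n _ hn] := cM w (prefix_cylinder _ _ _ su uw).
by have := hn (size u + n)%N (leq_addl _ _); rewrite /= ltNge hw.
Qed.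

Lemma supermartingale_affine M (a b : R) : (0 < a)%R ->
  (forall u, (- b)%:E <= M u) -> supermartingale Q M ->
  supermartingale Q (fun u => a%:E * (M u + b%:E)).
Proof.
move=> a0 bM [_ hM].
have M0 u : 0 <= M u + b%:E by rewrite -leeBlDr// sub0e -EFinN.
split; first by exists 0%R => u; rewrite mule_ge0// lee_fin ltW.
move=> s; rewrite (upexp_pscale (hQ s))//.
rewrite lee_pmul2l//; apply: le_trans (upexpDr (hQ s) _ _ _) _.
  by exists (- b)%R.
by rewrite leeD2r.
Qed.

(** The value [+oo] off the extensions of [s] makes the bound [m] global. Successors of an extension
    are extensions, and elsewhere the inequality has [+oo] on the right. *)
Lemma supermartingale_restrict M s (m : R) : (forall u, prefix s u -> m%:E <= M u) ->
  supermartingale Q M ->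
  supermartingale Q (fun u => if prefix s u then M u else +oo).
Proof.
move=> mM [_ hM]; split.
  by exists m => u; case: ifP => [/mM//|_]; rewrite leey.
move=> u; case: ifPn => [su|_]; last by rewrite leey.
rewrite (_ : (fun x => _) = (fun x => M (rcons u x)))//; apply/funext => x.
by rewrite (prefix_trans su (prefix_rcons _ _)).
Qed.

Lemma supermartingale_nneseries (T : nat -> situation X -> \bar R) :
  (forall k u, 0 <= T k u) -> (forall k, supermartingale Q (T k)) ->
  supermartingale Q (fun u => \sum_(0 <= k <oo) T k u).
Proof.
move=> T0 hT; split.
  by exists 0%R => u; apply: nneseries_ge0.
move=> s; apply: le_trans (upexp_nneseries_le (hQ s) (fun k x => T k (rcons s x)) _) _ => //.
apply: lee_nneseries => k _; first by move=> _; apply: (upexp_ge0 (hQ s)).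
by have [_] := hT k; apply.
Qed.

(* A position that can be bought at [t] whenever [E_V(f|t) < a]; the shift by
   [c] keeps its value above a positive constant, so that no bankruptcy threatens
   between two transactions. *)
Lemma buy_low_position (f : path_space X -> \bar R) (m a b : R) :
  (forall w, m%:E <= f w) -> (a < b)%R ->
  exists r d : R, [/\ (1 < r)%R, (0 < d)%R &
  forall t, global_upper_expectation Q f t < a%:E ->
  exists N, [/\ supermartingale Q N, forall u, d%:E <= N u, N t <= 1 &
    forall w, cylinder t w -> b%:E < f w ->
      \forall n \near \oo, r%:E < N (path_prefix w n)]].
Proof.
move=> mf ab.
have [c ac mc] : exists2 c, (0 < a + c)%R & (1 <= m + c)%R.
  exists (1 - Num.min m a)%R; rewrite addrCA.
    by rewrite ltr_wpDr// subr_ge0 ge_min lexx orbT.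
  by rewrite lerDl subr_ge0 ge_min lexx.
(* Dividing [M + c] by [a + c] brings the price to at most 1; the level [b] becomes [r], and the
   bound [M + c >= 1] becomes [d]. *)
exists ((b + c) / (a + c))%R, (a + c)^-1%R; split.
- by rewrite ltr_pdivlMr// mul1r ltrD2r.
- by rewrite invr_gt0.
move=> t /ereal_inf_lt[_ [M [hM fM] <-] Mta].
have mM : forall u, prefix t u -> m%:E <= M u.
  by apply: supermartingale_ge => // w tw; apply: le_trans (fM w tw).
have := supermartingale_restrict M t m mM hM; set M' := (fun u => _) => hM'.
have mM' u : m%:E <= M' u by rewrite /M'; case: ifP => [/mM//|_]; rewrite leey.
have d0 : (0 < (a + c)^-1)%R by rewrite invr_gt0.
exists (fun u => (a + c)^-1%:E * (M' u + c%:E)); split.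
- apply: supermartingale_affine => // u; apply: le_trans (mM' u).
  by rewrite lee_fin lerNl -subr_ge0 opprK addrC (le_trans ler01).
- move=> u; rewrite -[leLHS]mule1 lee_pmul2l//.
  apply: (@le_trans _ _ (m%:E + c%:E)); first by rewrite -EFinD lee_fin.
  by rewrite leeD2r.
- rewrite /M' prefix_refl lee_pdivrMl// mule1 EFinD leeD2r//; exact: ltW.
- move=> w tw bfw.
  have /limn_einf_gt_near : b%:E < limn_einf (fun n => M (path_prefix w n)).
    exact: lt_le_trans (fM w tw).
  move=> hn; near=> n.
  have tn : prefix t (path_prefix w n).
    by apply: cylinder_prefix => //; near: n; exists (size t).
  rewrite /M' tn mulrC EFinM lte_pmul2l// EFinD lteD2rE//.
  by near: n.
Unshelve. all: by end_near.
Qed.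

End supermartingale_theory.

(** * The strategy of buying low and selling high *)

Section trading.
Context {R : realType} {X : finType}.
Context {Q : situation X -> (X -> \bar R) -> \bar R}.
Hypothesis hQ : imprecise_tree Q.
Variables (s : situation X) (r d : R) (act : pred (situation X)).
Variable N : situation X -> situation X -> \bar R.
Hypotheses (r1 : (1 < r)%R) (d0 : (0 < d)%R).
Hypothesis N_supermartingale : forall t, act t -> supermartingale Q (N t).
Hypothesis N_ge : forall t u, act t -> d%:E <= N t u.
Hypothesis N_le1 : forall t, act t -> N t t <= 1.
Implicit Types (t u : situation X) (st : nat * option (situation X)).

(* The account holds the number of sales so far and, if a position is open, the
   situation where it was bought.  A sale credits exactly the factor [r] and
   discards the surplus, so that the capital stays real. *)
Definition trade st u : nat * option (situation X) :=
  if st.2 is Some t then if r%:E < N t u then (st.1.+1, None) else st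
  else if (size s < size u)%N && act u then (st.1, Some u) else st.

(** Situations grow at the right end, hence the recursion on the reversed string. *)
Fixpoint rev_account (v : situation X) : nat * option (situation X) :=
  if v is _ :: v' then trade (rev_account v') (rev v) else (0%N, None).

Definition account u := rev_account (rev u).

(** All capital is invested: [r ^+ st.1] counts units of the open position, or of cash. *)
Definition account_value st u : \bar R :=
  (r ^+ st.1)%:E * (if st.2 is Some t then N t u else 1).

Definition wealth u := account_value (account u) u.

Lemma account_rcons u x : account (rcons u x) = trade (account u) (rcons u x).
Proof. by rewrite /account rev_rcons /= -rev_rcons revK. Qed.

Lemma account_bought u t : (account u).2 = Some t -> act t /\ prefix t u.
Proof.
elim/last_ind: u => [//|u x IH]; rewrite account_rcons /trade.
case E : (account u).2 => [t'|]; last first.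
  by case: ifP => [/andP[_ au] [<-]|_]; [rewrite prefix_refl|rewrite E].
case: ifP => // _ /IH[act_t tu]; split=> //.
exact: prefix_trans tu (prefix_rcons _ _).
Qed.

Lemma account_start u : (size u <= size s)%N -> account u = (0%N, None).
Proof.
elim/last_ind: u => [//|u x IH]; rewrite size_rcons => us.
by rewrite account_rcons IH ?(ltnW us)// /trade /= size_rcons ltnNge us.
Qed.

Lemma expr_r_ge0 k : (0 <= r ^+ k)%R.
Proof. by rewrite exprn_ge0// ltW// (lt_trans ltr01). Qed.

(** A sale replaces a value above [r] by [r], a purchase replaces cash 1 by a position worth at most
    1. *)
Lemma trade_value_le st u : account_value (trade st u) u <= account_value st u.
Proof.
rewrite /account_value /trade; case E : st.2 => [t|].
  case: ifPn => [rN|_]; last by rewrite E.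
  by rewrite /= exprSr EFinM mule1 lee_wpmul2l ?lee_fin ?expr_r_ge0// ltW.
case: ifPn => [/andP[_ au]|_]; last by rewrite E.
by rewrite /= lee_wpmul2l ?lee_fin ?expr_r_ge0// N_le1.
Qed.

(** An open position is worth at least [d] and cash is worth 1, so wealth grows with the number of
    sales even during an open round. *)
Lemma wealth_ge u : (r ^+ (account u).1 * Num.min d 1)%:E <= wealth u.
Proof.
rewrite EFinM lee_wpmul2l ?lee_fin ?expr_r_ge0//.
case E : (account u).2 => [t|]; last by rewrite lee_fin ge_min lexx orbT.
have [act_t _] := account_bought _ _ E.
by apply: le_trans (N_ge t u act_t); rewrite lee_fin ge_min lexx.
Qed.

Lemma wealth_ge0 u : 0 <= wealth u.
Proof.
apply: le_trans (wealth_ge u).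
by rewrite lee_fin mulr_ge0 ?expr_r_ge0// le_min ler01 ltW.
Qed.

Lemma wealth_start : wealth s = 1.
Proof. by rewrite /wealth account_start// /account_value expr0 mule1. Qed.

(** Leaving out the trade at the successor can only raise the value there; with the account frozen,
    wealth is a multiple of one [N t] or constant. *)
Lemma wealth_supermartingale : supermartingale Q wealth.
Proof.
split; first by exists 0%R => u; exact: wealth_ge0.
move=> u; apply: (@le_trans _ _ (Q u (fun x => account_value (account u) (rcons u x)))).
  have le_x x : wealth (rcons u x) <= account_value (account u) (rcons u x).
    by rewrite /wealth account_rcons trade_value_le.
  apply: (upexp_le (hQ u)) => //; apply: bounded_below_ge0 => x.
    exact: wealth_ge0.
  exact: le_trans (wealth_ge0 _) (le_x x).
rewrite /wealth /account_value; case E : (account u).2 => [t|].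
  have [act_t _] := account_bought _ _ E.
  rewrite (upexp_pscale (hQ u)); last first.
  - by move=> x; apply: le_trans (N_ge t (rcons u x) act_t); rewrite lee_fin ltW.
  - by rewrite lte_fin exprn_gt0// (lt_trans ltr01).
  rewrite lee_wpmul2l ?lee_fin ?expr_r_ge0//.
  by have [_] := N_supermartingale t act_t; apply.
by rewrite mule1 (upexp_cst (hQ u)).
Qed.

Section on_path.
Variable w : path_space X.
Hypothesis N_sale : forall t, act t -> cylinder t w ->
  \forall n \near \oo, r%:E < N t (path_prefix w n).
Hypothesis act_frequently : forall n, exists2 k, (n <= k)%N & act (path_prefix w k).

Let acc n := account (path_prefix w n).

Let accS n : acc n.+1 = trade (acc n) (path_prefix w n.+1).
Proof. by rewrite /acc {1}path_prefixS account_rcons -path_prefixS. Qed.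

Let sales_leS n : ((acc n).1 <= (acc n.+1).1)%N.
Proof.
rewrite accS /trade; case E : (acc n).2 => [t|]; case: ifP => //.
Qed.

Let sales_le m n : (m <= n)%N -> ((acc m).1 <= (acc n).1)%N.
Proof. by apply: (@homo_leq _ (fun n => (acc n).1) leq) => //; exact: leq_trans. Qed.

Let position_opens n : exists2 n', (n <= n')%N & exists t, (acc n').2 = Some t.
Proof.
(* The successor gives the active index the form [k.+1] required by [accS] and places it beyond the
   length of [s], where purchases are allowed. *)
have [[//|k] nk ak] := act_frequently (maxn n (size s)).+1.
move: nk; rewrite ltnS geq_max => /andP[nk sk].
case E : (acc k).2 => [t|]; first by exists k => //; exists t.
exists k.+1; first exact: leqW.
exists (path_prefix w k.+1).
by rewrite accS /trade E size_path_prefix ltnS sk ak.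
Qed.

Let position_sold n t : (acc n).2 = Some t ->
  exists n', ((acc n).1 < (acc n').1)%N.
Proof.
(* Without a sale the account would keep the position [t] forever, against [N_sale]. *)
move=> ant; apply: contrapT => /forallNP nosale.
have [act_t tn] := account_bought _ _ ant.
have tw : cylinder t w := prefix_cylinder _ _ _ tn (cylinder_path_prefix w n).
have stuck i : acc (n + i)%N = acc n.
  elim: i => [|i IH]; first by rewrite addn0.
  rewrite addnS; have := nosale (n + i).+1; rewrite accS IH /trade ant.
  by case: ifP => // _ /=; rewrite ltnSn.
have [m _ hm] := N_sale t act_t tw.
apply: (nosale (n + m).+1); rewrite accS stuck /trade ant.
by rewrite hm ?ltnSn//=; rewrite leqW// leq_addl.
Qed.

Let sales_unbounded k : exists n, (k <= (acc n).1)%N.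
Proof.
elim: k => [|k [n kn]]; first by exists 0%N.
have [n' nn' [t n't]] := position_opens n.
have [n'' n'n''] := position_sold _ _ n't.
by exists n''; apply: leq_ltn_trans n'n''; apply: leq_trans kn (sales_le _ _ nn').
Qed.

Lemma wealth_cvgy : wealth (path_prefix w n) @[n --> \oo] --> +oo.
Proof.
apply/cvgeyPge => A; set e := Num.min d 1%R.
have e0 : (0 < e)%R by rewrite lt_min d0 ltr01.
(* Bernoulli's inequality reduces [A / e <= r ^+ k] to [A / e <= k * (r - 1)], an Archimedean choice
   of [k]. *)
pose k := Num.bound `|A / e / (r - 1)|%R.
have bernoulli j : (j%:R * (r - 1) <= r ^+ j)%R.
  elim: j => [|j IH]; first by rewrite mul0r expr0.
  have -> : (r ^+ j.+1 = r ^+ j + r ^+ j * (r - 1))%R.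
    by rewrite mulrBr mulr1 addrC subrK exprSr.
  rewrite -natr1 mulrDl mul1r lerD// ler_peMl ?subr_ge0 ?(ltW r1)//.
  by rewrite exprn_ege1// ltW.
have [n kn] := sales_unbounded k.
exists n => // n' /= nn'; apply: le_trans (wealth_ge _).
rewrite lee_fin -ler_pdivrMr//.
apply: (@le_trans _ _ (r ^+ k)%R).
  apply: le_trans (bernoulli k); rewrite -ler_pdivrMr ?subr_gt0//.
  by apply: ltW; apply: le_lt_trans (ler_norm _) _; apply: archi_boundP; exact: normr_ge0.
by rewrite ler_weXn2l ?(ltW r1)//; apply: leq_trans kn (sales_le _ _ nn').
Qed.

End on_path.

End trading.

(** * Fixed levels, mixtures and the zero-one law *)

Lemma trading_supermartingale (R : realType) (X : finType) (hX : (0 < #|X|)%N)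
    (Q : situation X -> (X -> \bar R) -> \bar R) (hQ : imprecise_tree Q)
    (f : path_space X -> \bar R) (hf : bounded_below f) (s : situation X)
    (a b : R) : (a < b)%R ->
  exists T, test_supermartingale Q s T /\
    forall w, b%:E < f w ->
      liminf_path (global_upper_expectation Q f) w < a%:E ->
      T (path_prefix w n) @[n --> \oo] --> +oo.
Proof.
have [m mf] := hf; move=> ab.
have [r [d [r1 d0 hN]]] := buy_low_position hX hQ f m a b mf ab.
pose act t := global_upper_expectation Q f t < a%:E.
have {hN}/choice[N hN] : forall t, exists N, act t -> [/\ supermartingale Q N,
    forall u, d%:E <= N u, N t <= 1 & forall w, cylinder t w -> b%:E < f w ->
      \forall n \near \oo, r%:E < N (path_prefix w n)].
  move=> t; case E : (act t); last by exists (fun=> 0).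
  by have [N Nt] := hN t E; exists N.
have N1 t : act t -> supermartingale Q (N t) by move=> /hN[].
have N2 t u : act t -> d%:E <= N t u by move=> /hN[].
have N3 t : act t -> N t t <= 1 by move=> /hN[].
exists (wealth s r act N); split.
  split.
  - by apply: (wealth_supermartingale hQ s r d).
  - by apply: (wealth_ge0 s r d).
  - exact: wealth_start.
move=> w bfw va; apply: (wealth_cvgy s r d) => //.
- by move=> t /hN[_ _ _ hNt] tw; apply: hNt.
- exact: limn_einf_lt_frequently.
Qed.

(** The weights [c k], halving from 1/2, sum to 1, so the mixture is 1 at [s]. The other terms being
    non-negative, divergence of one [T k] passes to the mixture. *)
Lemma mixture_test_supermartingale (R : realType) (X : finType)
    (Q : situation X -> (X -> \bar R) -> \bar R) (hQ : imprecise_tree Q)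
    (s : situation X) (T : nat -> situation X -> \bar R) :
  (forall k, test_supermartingale Q s (T k)) ->
  exists U, test_supermartingale Q s U /\
    forall k, exists2 c : R, (0 < c)%R & forall u, c%:E * T k u <= U u.
Proof.
move=> hT; pose c k : R := (1 / (2 ^ (k + 1))%:R)%R.
have c0 k : (0 < c k)%R by rewrite divr_gt0// ltr0n expn_gt0.
have T0 k u : 0 <= T k u by have [_ ->] := hT k.
have cT0 k u : 0 <= (c k)%:E * T k u by rewrite mule_ge0// lee_fin ltW.
exists (fun u => \sum_(0 <= k <oo) (c k)%:E * T k u); split; last first.
  move=> k; exists (c k) => // u.
  rewrite (nneseriesD1 (n := k))// leeDl//.
  by apply: nneseries_ge0.
split.
- apply: (supermartingale_nneseries hQ) => // k.
  have [Tk _ _] := hT k.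
  have := supermartingale_affine hQ (T k) (c k) 0 (c0 k) _ Tk.
  under eq_fun do rewrite adde0; apply=> u; by rewrite oppr0.
- by move=> u; apply: nneseries_ge0.
- rewrite (@eq_eseriesr _ _ (fun k => (c k)%:E)); last first.
    by move=> k _; have [_ _ ->] := hT k; rewrite mule1.
  have := @cvg_geometric_eseries_half _ (1%R : R) 0.
  by rewrite expr0 divr1 => /cvg_lim; apply.
Qed.

Theorem theorem22 (R : realType) (X : finType) (hX : (0 < #|X|)%N)
    (Q : situation X -> (X -> \bar R) -> \bar R) (hQ : imprecise_tree Q)
    (f : path_space X -> \bar R) (hf : bounded_below f) (s' : situation X) :
  strictly_almost_sure Q s'
    [set w | cylinder s' w /\
             f w <= liminf_path (global_upper_expectation Q f) w].
Proof.
split; first by move=> w [].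
(* Rational pairs enter the mixture by their codes; a code of no pair [p < q] gets the default [T1],
   built for the levels 0 and 1. *)
have /choice[T hT] : forall k, exists T, test_supermartingale Q s' T /\
    forall p q : rat, unpickle k = Some (p, q) -> (p < q)%R ->
    forall w, (ratr q)%:E < f w ->
      liminf_path (global_upper_expectation Q f) w < (ratr p)%:E ->
      T (path_prefix w n) @[n --> \oo] --> +oo.
  have [T1 [hT1 _]] := trading_supermartingale _ _ hX _ hQ f hf s' 0 1 ltr01.
  move=> k; case: (unpickle k) => [[p q]|]; last by exists T1.
  have [pq|qp] := boolP (p < q)%R; last first.
    by exists T1; split=> // p' q' [<- <-]; rewrite (negbTE qp).
  have pqR : (ratr p < ratr q :> R)%R by rewrite ltr_rat.
  have [T [hT TP]] := trading_supermartingale _ _ hX _ hQ f hf s' _ _ pqR.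
  by exists T; split=> // _ _ [<- <-].
have [U [hU UT]] := mixture_test_supermartingale _ _ _ hQ s' T (fun k => (hT k).1).
exists U; split=> // w [sw nA].
(* Off the event, two rationals fit strictly between the limit inferior and [f w]; the component of
   that pair diverges. *)
have /ratr_between[p /andP[vp pf]] :
    liminf_path (global_upper_expectation Q f) w < f w.
  by rewrite ltNge; apply/negP => fv; apply: nA.
have [q /andP[pq qf]] := ratr_between _ _ _ pf.
have {}pq : (p < q)%R by move: pq; rewrite lte_fin ltr_rat.
have Tcvg := (hT (pickle (p, q))).2 p q (pickleK _) pq w qf vp.
have [c c0 cU] := UT (pickle (p, q)).
apply/cvgeyPge => A.
apply: filterS (cvgey_ge Tcvg (c^-1 * A)%R) => n AT.
by apply: le_trans (cU _); rewrite -lee_pdivrMl.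
Qed.
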